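(* Let $V$ be an irreducible differential variety over $\mathcal F$ of dimension $d$ and let $\overline x\in\mathcal E^n$. Then $\overline x\in V$ if and only if $d+1$ independent generic differential hyperplanes $\mathbb P_0,\mathbb P_1,\ldots,\mathbb P_d$ passing through $\overline x$ meet $V$ (i.e. have a common zero in $V$).
   Context: $\mathcal F$ ordinary differential field of characteristic $0$, $\mathcal E$ universal differential extension. A generic differential hyperplane passing through a point $x=(x_1,\dots,x_n)$ is $a_0+a_1y_1+\dots+a_ny_n=0$ with $(a_0,\dots,a_n)^T=S(1,x_1,\dots,x_n)^T$, where $S=(s_{ij})$ is an $(n+1)\times(n+1)$ skew-symmetric matrix whose entries $s_{ij}$ $(i<j)$ are differential indeterminates over $\mathcal F\langle x\rangle$ in $\mathcal E$; several such hyperplanes are independent if all their entries $s_{ij}$ together are differentially independent. *)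

(* Defs.v *)
From HB Require Import structures.
From mathcomp Require Import all_boot all_order all_algebra.
From mathcomp Require Import mpoly.
Set Implicit Arguments. Unset Strict Implicit. Unset Printing Implicit Defensive.
Import Order.TTheory GRing.Theory.
Local Open Scope ring_scope.

Definition derivation (R : nzRingType) (D : R -> R) : Prop :=
  (forall a b, D (a + b) = D a + D b) /\ (forall a b, D (a * b) = D a * b + a * D b).

Definition diff_subfield (E : fieldType) (D : E -> E) (K : E -> Prop) : Prop :=
  [/\ K 0, K 1,
      (forall a b, K a -> K b -> K (a - b)),
      (forall a b, K a -> K b -> K (a * b)) &
      (forall a, K a -> K a^-1 /\ K (D a))].

Definition mpoly_over (R : nzRingType) (m : nat) (K : R -> Prop) (p : {mpoly R[m]}) : Prop :=
  forall mo, K (p@_mo).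

(* Differential polynomials in n differential indeterminates y_0..y_{n-1}: *)
(* a differential polynomial of order <= k is an ordinary polynomial in the *)
(* variables y_i^{(j)}, (j,i) : 'I_k.+1 * 'I_n (enumerated by enum_val).    *)

Definition djvar (k n : nat) := ('I_k.+1 * 'I_n)%type.

Record dpoly (R : nzRingType) (n : nat) := DPoly {
  dp_ord : nat;
  dp_poly : {mpoly R[#|{: djvar dp_ord n}|]} }.

Definition djet (R : nzRingType) (D : R -> R) (n k : nat) (y : 'cV[R]_n)
  (v : 'I_#|{: djvar k n}|) : R :=
  let: (j, i) := enum_val v in iter j D (y i 0).

Definition deval (R : comNzRingType) (D : R -> R) (n : nat) (P : dpoly R n)
  (y : 'cV[R]_n) : R :=
  (dp_poly P).@[@djet R D n (dp_ord P) y].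

Definition dpoly_over (R : nzRingType) (n : nat) (K : R -> Prop) (P : dpoly R n) : Prop :=
  mpoly_over K (dp_poly P).

Definition dgen (E : fieldType) (D : E -> E) (K : E -> Prop) (m : nat)
  (x : 'cV[E]_m) (z : E) : Prop :=
  exists P Q : dpoly E m, [/\ dpoly_over K P, dpoly_over K Q,
    deval D Q x != 0 & z = deval D P x / deval D Q x].

Definition alg_indep (E : fieldType) (K : E -> Prop) (J : Type) (w : J -> E) : Prop :=
  forall (m : nat) (f : 'I_m -> J) (p : {mpoly E[m]}),
    injective f -> mpoly_over K p -> p.@[fun i => w (f i)] = 0 -> p = 0.

Definition diff_indep (E : fieldType) (D : E -> E) (K : E -> Prop) (J : Type)
  (u : J -> E) : Prop :=
  alg_indep K (fun t : nat * J => iter t.1 D (u t.2)).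

(* Universal differential extension E of F (Kolchin): for every finitely   *)
(* generated differential subfield K = F<x> of E and every finitely        *)
(* generated differential field extension L of K (given through a          *)
(* differential embedding phi of K into L), L embeds into E over K.        *)

Definition diff_ring_hom_on (A B : nzRingType) (DA : A -> A) (DB : B -> B)
  (K : A -> Prop) (f : A -> B) : Prop :=
  [/\ f 1 = 1,
      (forall a b, K a -> K b -> f (a + b) = f a + f b),
      (forall a b, K a -> K b -> f (a * b) = f a * f b)
    & (forall a, K a -> f (DA a) = DB (f a))].

Definition universal_diff_ext (E : fieldType) (D : E -> E) (F : E -> Prop) : Prop :=
  forall (m : nat) (x : 'cV[E]_m) (L : fieldType) (DL : L -> L) (phi : E -> L),
    derivation DL ->
    diff_ring_hom_on D DL (dgen D F x) phi ->
    (exists (m' : nat) (l : 'cV[L]_m'), forall z : L,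
        dgen DL (fun c => exists k, dgen D F x k /\ c = phi k) l z) ->
    exists psi : L -> E,
      diff_ring_hom_on DL D (fun _ => True) psi /\
      (forall k, dgen D F x k -> psi (phi k) = k).

Definition diff_setting (E : fieldType) (D : E -> E) (F : E -> Prop) : Prop :=
  [/\ derivation D, [pchar E] =i pred0, diff_subfield D F & universal_diff_ext D F].

Definition diff_variety (E : fieldType) (D : E -> E) (F : E -> Prop) (n : nat)
  (V : 'cV[E]_n -> Prop) : Prop :=
  exists S : dpoly E n -> Prop,
    (forall P, S P -> dpoly_over F P) /\
    (forall y, V y <-> (forall P, S P -> deval D P y = 0)).

Definition irreducible_diff_variety (E : fieldType) (D : E -> E) (F : E -> Prop)
  (n : nat) (V : 'cV[E]_n -> Prop) : Prop :=
  [/\ diff_variety D F V, (exists y, V y) &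
      forall V1 V2, diff_variety D F V1 -> diff_variety D F V2 ->
        (forall y, V y <-> (V1 y \/ V2 y)) ->
        (forall y, V y <-> V1 y) \/ (forall y, V y <-> V2 y)].

Definition generic_point (E : fieldType) (D : E -> E) (F : E -> Prop) (n : nat)
  (V : 'cV[E]_n -> Prop) (eta : 'cV[E]_n) : Prop :=
  V eta /\ forall P : dpoly E n, dpoly_over F P -> deval D P eta = 0 ->
    forall y, V y -> deval D P y = 0.

Definition diff_trdeg (E : fieldType) (D : E -> E) (F : E -> Prop) (n : nat)
  (eta : 'cV[E]_n) (d : nat) : Prop :=
  (exists I : {set 'I_n}, #|I| = d /\ diff_indep D F (fun i : {i | i \in I} => eta (val i) 0))
  /\ (forall I : {set 'I_n},
        diff_indep D F (fun i : {i | i \in I} => eta (val i) 0) -> (#|I| <= d)%N).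

Definition diff_dim (E : fieldType) (D : E -> E) (F : E -> Prop) (n : nat)
  (V : 'cV[E]_n -> Prop) (d : nat) : Prop :=
  exists eta, generic_point D F V eta /\ diff_trdeg D F eta d.

Definition hvec (E : nzRingType) (n : nat) (y : 'cV[E]_n) : 'cV[E]_(1 + n) :=
  col_mx 1%:M y.

Definition skew (E : nzRingType) (m : nat) (S : 'M[E]_m) : Prop := S^T = - S.

(* y lies on the hyperplane a_0 + a_1 y_1 + ... + a_n y_n = 0,
   where (a_0,...,a_n)^T = S (1,x)^T *)
Definition on_hyperplane (E : nzRingType) (n : nat) (S : 'M[E]_(1 + n))
  (x y : 'cV[E]_n) : Prop :=
  (hvec y)^T *m (S *m hvec x) = 0.

Definition upper_idx (c m : nat) :=
  {t : 'I_c * 'I_m * 'I_m | (t.1.2 < t.2)%N}.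

Definition indep_generic_hyperplanes (E : fieldType) (D : E -> E) (F : E -> Prop)
  (n c : nat) (x : 'cV[E]_n) (S : 'I_c -> 'M[E]_(1 + n)) : Prop :=
  (forall k, skew (S k)) /\
  diff_indep D (dgen D F x) (fun t : upper_idx c (1 + n) =>
     S (val t).1.1 (val t).1.2 (val t).2).

(* Main.v *)
Require Import Defs.
From HB Require Import structures.
From mathcomp Require Import all_boot all_order all_algebra.
From mathcomp Require Import mpoly.
From mathcomp Require Import ring zify.
From Stdlib Require Import Classical ClassicalEpsilon.

(* If x is in V, then x itself lies on every hyperplane through x, because the
   matrices are skew-symmetric and the characteristic is not 2.
   Conversely let y in V, y <> x, lie on the hyperplanes.  If y_j <> x_j, the
   k-th equation expresses the entry s^k_{0j} rationally through x, y and the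
   remaining entries, so the (d+1)(h+1) derivatives of order <= h of these d+1
   entries are algebraic over the derivatives of order <= h of x, y and the
   remaining entries.  The derivatives of y of order <= h have transcendence
   degree at most that of a generic point of V, which is d h + O(1).  As the
   s^k_{0j} are differentially independent over x and the other entries,
   (d+1)(h+1) <= d h + O(1) for all h, a contradiction.
   Transcendence degrees are handled through the exchange property of relative
   algebraic closure in E. *)

Set Implicit Arguments. Unset Strict Implicit. Unset Printing Implicit Defensive.
Import GRing.Theory.
Local Open Scope ring_scope.

(** * Subfields of a field as field types *)

Section SubfieldType.
Variables (E : fieldType) (S : divringClosed E).
Record subfield := Subfield { subfield_val : E; _ : subfield_val \in S }.
HB.instance Definition _ := [isSub for subfield_val].
HB.instance Definition _ := [Choice of subfield by <:].
HB.instance Definition _ := [SubChoice_isSubIntegralDomain of subfield by <:].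
HB.instance Definition _ := [SubIntegralDomain_isSubField of subfield by <:].
End SubfieldType.

(** * Relative algebraic closure *)

Section AlgebraicClosure.
Variable E : fieldType.
Implicit Types (K C A : E -> Prop) (a b : E).

Definition subring K : Prop :=
  [/\ K 1, forall a b, K a -> K b -> K (a - b)
    & forall a b, K a -> K b -> K (a * b)].

Definition alg_over K a : Prop :=
  exists p : {poly E}, [/\ p != 0, forall i, K p`_i & root p a].

Definition aclosed C : Prop :=
  subring C /\ forall a, alg_over C a -> C a.

(** Taking the intersection of all algebraically closed subrings containing [A] gives an induction
    principle: a property holds on [acl A] once it defines an [aclosed] set containing [A]. *)
Definition acl A a : Prop :=
  forall C, aclosed C -> (forall z, A z -> C z) -> C a.

(** Excluded middle turns a [Prop]-valued predicate into a boolean one, so that the closure lemmas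
    [rpredB], [rpredM], ... apply to it. *)
Definition bool_of_pred K : pred E :=
  fun z => if excluded_middle_informative (K z) then true else false.

Lemma bool_of_predP K z : reflect (K z) (z \in bool_of_pred K).
Proof.
by rewrite unfold_in; case: excluded_middle_informative => h; constructor.
Qed.

Lemma subring_pred K : subring K ->
  exists S : subringClosed E, forall z, K z <-> z \in S.
Proof.
case=> K1 KB KM.
have H : subring_closed (bool_of_pred K).
  split; first exact/bool_of_predP.
    by move=> a b /bool_of_predP Ka /bool_of_predP Kb; apply/bool_of_predP/KB.
  by move=> a b /bool_of_predP Ka /bool_of_predP Kb; apply/bool_of_predP/KM.
pose S : subringClosed E :=
  HB.pack (bool_of_pred K) (GRing.isSubringClosed.Build E (bool_of_pred K) H).
by exists S => z; apply: rwP; apply: bool_of_predP.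
Qed.

Lemma divring_pred K : subring K -> (forall a, K a -> K a^-1) ->
  exists S : divringClosed E, forall z, K z <-> z \in S.
Proof.
case=> K1 KB KM KV.
have H : divring_closed (bool_of_pred K).
  split; first exact/bool_of_predP.
    by move=> a b /bool_of_predP Ka /bool_of_predP Kb; apply/bool_of_predP/KB.
  move=> a b /bool_of_predP Ka /bool_of_predP Kb.
  by apply/bool_of_predP/KM => //; apply: KV.
pose S : divringClosed E :=
  HB.pack (bool_of_pred K) (GRing.isDivringClosed.Build E (bool_of_pred K) H).
by exists S => z; apply: rwP; apply: bool_of_predP.
Qed.

Lemma alg_over_sub K K' a :
  (forall z, K z -> K' z) -> alg_over K a -> alg_over K' a.
Proof. by move=> sKK' [p [p0 Kp pa]]; exists p; split=> // i; apply/sKK'. Qed.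

Lemma alg_over_refl K a : subring K -> K a -> alg_over K a.
Proof.
case/subring_pred=> S KS /KS Sa; exists ('X - a%:P); split.
- by rewrite polyXsubC_eq0.
- by move=> i; apply/KS/polyOverP; rewrite polyOverXsubC.
- by rewrite root_XsubC.
Qed.

(** Over a field, algebraic and integral elements coincide, and integrality is transitive. *)
Lemma aclosed_alg_over_subfield K :
  subring K -> (forall a, K a -> K a^-1) -> aclosed (alg_over K).
Proof.
move=> rK KV; have [S KS] := divring_pred rK KV.
pose f : {rmorphism subfield S -> E} := \val.
have algE a : alg_over K a <-> algebraicOver f a.
  split=> [[p [p0 Kp pa]] | [q q0 qa]]; last first.
    exists (map_poly f q); split=> // [|i]; first by rewrite map_poly_eq0.
    by rewrite coef_map; apply/KS/(valP q`_i).
  (* All coefficients lie in [S], so the default value 0 is never taken. *)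
  pose q : {poly subfield S} := \poly_(i < size p) insubd 0 p`_i.
  have qE : map_poly f q = p.
    apply/polyP=> i; rewrite coef_map coef_poly.
    case: ltnP => [_|szp]; last by rewrite (nth_default 0 szp).
    by rewrite /f /= val_insubd; move/KS: (Kp i) => ->.
  by exists q; rewrite ?qE // -(map_poly_eq0 f) qE.
split; first split.
- exact/algE/algebraic1.
- by move=> a b /algE ? /algE ?; apply/algE/algebraic_sub.
- by move=> a b /algE ? /algE ?; apply/algE/algebraic_mul.
move=> a [p [p0 Kp pa]]; apply/algE/integral_algebraic.
apply: (integral_root p0 pa); apply/integral_poly => i.
by apply/integral_algebraic/algE/Kp.
Qed.

Definition fractions K a : Prop :=
  exists u v, [/\ K u, K v, v != 0 & a = u / v].

Lemma subring_fractions K : subring K -> subring (fractions K).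
Proof.
move=> rK; have [S KS] := subring_pred rK.
split.
- by exists 1, 1; split; rewrite ?divr1 ?oner_eq0 //; apply/KS/rpred1.
- move=> _ _ [a [b [/KS Sa /KS Sb b0 ->]]] [c [d [/KS Sc /KS Sd d0 ->]]].
  exists (a * d - c * b), (b * d); split.
  + by apply/KS; rewrite rpredB ?rpredM.
  + by apply/KS; rewrite rpredM.
  + by rewrite mulf_neq0.
  + by rewrite -mulNr addf_div // mulNr.
- move=> _ _ [a [b [/KS Sa /KS Sb b0 ->]]] [c [d [/KS Sc /KS Sd d0 ->]]].
  exists (a * c), (b * d); split.
  + by apply/KS; rewrite rpredM.
  + by apply/KS; rewrite rpredM.
  + by rewrite mulf_neq0.
  + by rewrite mulf_div.
Qed.

Lemma fractions_inv K a : subring K -> fractions K a -> fractions K a^-1.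
Proof.
case=> K1 KB KM [u [v [Ku Kv v0 ->]]]; rewrite invf_div.
have [->|u0] := eqVneq u 0; last by exists v, u.
exists 0, 1; split; rewrite ?oner_eq0 ?invr0 ?mulr0 ?mul0r //.
by rewrite -(subrr 1); apply: KB.
Qed.

Lemma common_denominator K (s : seq E) : subring K ->
  (forall z, z \in s -> fractions K z) ->
  exists v, [/\ K v, v != 0 & forall z, z \in s -> K (v * z)].
Proof.
case=> K1 _ KM; elim: s => [|a s IHs] Fs; first by exists 1; rewrite oner_eq0.
have [|v [Kv v0 Ks]] := IHs.
  by move=> z zs; apply: Fs; rewrite inE zs orbT.
have [|c [d [Kc Kd d0 aE]]] := Fs a; first by rewrite mem_head.
exists (v * d); split; [exact: KM | by rewrite mulf_neq0 |] => z.
rewrite inE => /orP[/eqP->|zs].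
  by rewrite aE -mulrA [d * _]mulrC divfK //; apply: KM.
by rewrite mulrAC; apply: KM => //; apply: Ks.
Qed.

Lemma alg_over_fractions K a :
  subring K -> alg_over (fractions K) a <-> alg_over K a.
Proof.
move=> rK; split; last first.
  apply: alg_over_sub => z Kz; exists z, 1.
  by case: rK => K1 _ _; rewrite divr1 oner_eq0.
case=> p [p0 Fp pa].
have [|v [Kv v0 Kvp]] := @common_denominator K p rK.
  by move=> _ /(nthP 0)[i _ <-].
exists (v *: p); split.
- by rewrite scale_poly_eq0 negb_or v0.
- move=> i; rewrite coefZ.
  have [lip|/(nth_default 0) ->] := ltnP i (size p).
    exact/Kvp/mem_nth.
  by rewrite mulr0 -(subrr 1); case: rK => ? KB _; apply: KB.
- by rewrite /root hornerZ (rootP pa) mulr0.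
Qed.

(** Clearing denominators reduces this to the fraction field of [K]. *)
Lemma aclosed_alg_over K : subring K -> aclosed (alg_over K).
Proof.
move=> rK; have [] := aclosed_alg_over_subfield (subring_fractions rK).
  by move=> a; apply: fractions_inv.
have E1 a := alg_over_fractions a rK.
case=> C1 CB CM CA; split; first split.
- exact/E1.
- by move=> a b /E1 ? /E1 ?; apply/E1/CB.
- by move=> a b /E1 ? /E1 ?; apply/E1/CM.
- by move=> a aa; apply/E1/CA/alg_over_sub/aa => z /E1.
Qed.

Lemma acl_aclosed A : aclosed (acl A).
Proof.
split; first split.
- by move=> C [[]].
- move=> a b ha hb C cC AC; have [[_ CB _] _] := cC.
  by apply: CB; [apply: ha | apply: hb].
- move=> a b ha hb C cC AC; have [[_ _ CM] _] := cC.
  by apply: CM; [apply: ha | apply: hb].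
- move=> a ha C cC AC; have [_ CA] := cC.
  by apply: CA; apply: alg_over_sub ha => z; apply.
Qed.

Lemma acl_gen A a : A a -> acl A a.
Proof. by move=> Aa C _; apply. Qed.

Lemma acl_sub A B a : (forall z, A z -> acl B z) -> acl A a -> acl B a.
Proof. by move=> AB; apply => //; apply: acl_aclosed. Qed.

Lemma acl_mono A B a : (forall z, A z -> B z) -> acl A a -> acl B a.
Proof. by move=> AB; apply: acl_sub => z /AB/acl_gen. Qed.

Lemma acl_alg_over K A a : subring K -> (forall z, A z -> K z) ->
  acl A a -> alg_over K a.
Proof.
move=> rK AK; apply; first exact: aclosed_alg_over.
by move=> z /AK; apply: alg_over_refl.
Qed.

Lemma aclosed_linear C u v a : aclosed C ->
  C u -> C v -> u != 0 -> u * a = v -> C a.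
Proof.
move=> [rC CA] Cu Cv u0 uav; apply: CA.
have [S CS] := subring_pred rC; move/CS: Cu => Su; move/CS: Cv => Sv.
exists (u *: 'X - v%:P); split.
- apply/eqP => /(congr1 (fun p : {poly E} => p`_1)).
  by rewrite coefB coefZ coefX coefC coef0 /= subr0 mulr1; apply/eqP.
- move=> i; apply/CS; have /polyOverP : u *: 'X - v%:P \is a polyOver S.
    by rewrite rpredB ?polyOverC // polyOverZ ?polyOverX.
  exact.
- by rewrite /root !hornerE uav subrr.
Qed.

(* A polynomial for [a] over C[b] is the specialization at [b] of a bivariate
   polynomial over [C]; specialized at [a] instead, it is nonzero since [a] is
   transcendental over [C]. *)
Lemma acl_exchange C a b : aclosed C -> ~ C a ->
  acl (fun z => C z \/ z = b) a -> acl (fun z => C z \/ z = a) b.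
Proof.
move=> cC nCa; have [rC CA] := cC; have [S CS] := subring_pred rC.
pose K z := exists2 p : {poly E}, p \is a polyOver S & z = p.[b].
have rK : subring K.
  split.
  - by exists 1; rewrite ?rpred1 ?hornerE.
  - move=> _ _ [p Sp ->] [q Sq ->].
    by exists (p - q); rewrite ?hornerE // rpredB.
  - move=> _ _ [p Sp ->] [q Sq ->].
    by exists (p * q); rewrite ?hornerE // rpredM.
move/(acl_alg_over rK); case.
  move=> z [/CS Sz | ->]; first by exists z%:P; rewrite ?polyOverC ?hornerE.
  by exists 'X; rewrite ?polyOverX ?hornerE.
move=> p [p0 Kp pa].
have /fin_all_exists2[f Sf fE] : forall i : 'I_(size p),
    exists2 q : {poly E}, q \is a polyOver S & p`_i = q.[b].
  by move=> i; apply: Kp.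
pose P : {poly {poly E}} := \poly_(i < size p) oapp f 0 (insub i).
have SP i : P`_i \is a polyOver S.
  rewrite coef_poly; case: ltnP => // [lip|_]; last by rewrite rpred0.
  by rewrite insubT /=.
have PE : map_poly (horner_eval b) P = p.
  apply/polyP=> i; rewrite coef_map coef_poly.
  case: ltnP => [lip|szp]; last first.
    by rewrite (nth_default 0 szp) raddf0.
  by rewrite insubT /= /horner_eval -fE.
pose q := map_poly (horner_eval a) (swapXY P).
(* If [q] vanished, [a] would be a root of every coefficient of [swapXY P]; one of them is nonzero,
   so [a] would be algebraic over [C]. *)
have q0 : q != 0.
  apply/eqP => qz; case/negP: p0; rewrite -PE; apply/eqP.
  suff -> : P = 0 by rewrite rmorph0.
  apply/eqP; rewrite -swapXY_eq0; apply/eqP/polyP => i; rewrite coef0.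
  have := congr1 (fun r : {poly E} => r`_i) qz.
  rewrite coef_map coef0 => hi; apply/eqP; apply/negPn/negP => si0.
  case: nCa; apply: CA; exists ((swapXY P)`_i); split=> //.
    by move=> j; rewrite coef_swapXY; apply/CS/(polyOverP (SP j)).
  exact/eqP.
have qb : root q b.
  move: pa; rewrite /root /q -horner_polyC -PE -{1}(hornerC a b).
  by rewrite horner_map.
have cCa := acl_aclosed (fun z => C z \/ z = a).
case: (cCa) => /subring_pred[Sa CSa] CaA.
apply: CaA; exists q; split=> // i; apply/CSa.
rewrite coef_map /horner_eval rpred_horner //; last first.
  by apply/CSa; apply: acl_gen; right.
apply/polyOverP => j; apply/CSa; apply: acl_gen; left; rewrite coef_swapXY.
by apply/CS/(polyOverP (SP j)).
Qed.

End AlgebraicClosure.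

(** * Independent sequences and their exchange property *)

Section AlgebraicIndependence.
Variable E : fieldType.
Implicit Types (A B : E -> Prop) (a b : E) (s t : seq E).

Definition adj1 A b : E -> Prop := fun z => A z \/ z = b.
Definition adj A s : E -> Prop := fun z => A z \/ z \in s.

(** Each element is transcendental over [A] and its predecessors. That the order is irrelevant is
    the content of [indep_perm]. *)
Fixpoint indep A s : Prop :=
  if s is a :: s' then ~ acl A a /\ indep (adj1 A a) s' else True.

Lemma adj_consE A a s z : adj A (a :: s) z <-> adj (adj1 A a) s z.
Proof.
rewrite /adj /adj1 inE; split.
  by case=> [Az|/orP[/eqP->|zs]]; [do 2 left | left; right | right].
by case=> [[Az|->]|zs]; [left | right; rewrite eqxx | right; rewrite zs orbT].
Qed.

Lemma acl_adj_nil A a : acl (adj A [::]) a -> acl A a.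
Proof. by apply: acl_mono => z []. Qed.

Lemma acl_adj_base A s a : acl A a -> acl (adj A s) a.
Proof. by apply: acl_mono => z; left. Qed.

Lemma acl_adj_mem A s a : a \in s -> acl (adj A s) a.
Proof. by move=> sa; apply: acl_gen; right. Qed.

Lemma acl_exchange1 A a b : ~ acl A a -> acl (adj1 A b) a -> acl (adj1 A a) b.
Proof.
move=> nAa ab.
have : acl (fun z => acl A z \/ z = a) b.
  apply: acl_exchange nAa _; first exact: acl_aclosed.
  by apply: acl_mono ab => z [/acl_gen|]; [left|right].
apply: acl_sub => z [|->]; last by apply: acl_gen; right.
by apply: acl_mono; left.
Qed.

Lemma indep_sub A B s : (forall z, A z -> acl B z) -> indep B s -> indep A s.
Proof.
elim: s => //= a s IHs in A B *; move=> AB [nBa Bs]; split.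
  by move/(acl_sub AB).
apply: IHs Bs => z [/AB|->]; last by apply: acl_gen; right.
by apply: acl_mono; left.
Qed.

(** Adjoining [b] to the base costs at most one element: the first one that becomes algebraic is
    exchanged for [b], and the later ones stay independent. *)
Lemma indep_adj1 A b s : indep A s ->
  exists s', [/\ {subset s' <= s}, (size s <= (size s').+1)%N
               & indep (adj1 A b) s'].
Proof.
elim: s A => [|a s IHs] A /=; first by exists [::].
case=> nAa As; have [ba|nba] := classic (acl (adj1 A b) a).
  exists s; split=> // [z zs|]; first by rewrite inE zs orbT.
  apply: indep_sub As => z [Az|->]; first by apply: acl_gen; left.
  exact: acl_exchange1.
have [s' [ss' sz is']] := IHs _ As.
exists (a :: s'); split=> //=.
  by move=> z; rewrite !inE => /orP[->|/ss' ->] //; rewrite orbT.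
split=> //; apply: indep_sub is' => z [[Az|->]|->]; apply: acl_gen.
- by left; left.
- by right.
- by left; right.
Qed.

(** Steinitz: the elements of [t] are moved into the base one at a time, each costing at most one
    element of [s]. *)
Lemma indep_leq_size A s t : indep A s ->
  (forall z, z \in s -> acl (adj A t) z) -> (size s <= size t)%N.
Proof.
elim: t A s => [|b t IHt] A s As st.
  case: s As st => //= a s [nAa _] /(_ a); rewrite mem_head => /(_ isT) Aa.
  by case: nAa; apply: acl_adj_nil.
have [s' [ss' sz is']] := indep_adj1 b As.
apply: leq_trans sz _; apply: IHt is' _ => z /ss'/st.
by apply: acl_mono => y /adj_consE.
Qed.

Lemma indep_cat A s t : indep A (s ++ t) <-> indep A s /\ indep (adj A s) t.
Proof.
elim: s A => [|a s IHs] A /=.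
  split=> [At|[_]]; [split=> // |].
    by apply: indep_sub At => z [/acl_gen|].
  by apply: indep_sub => z Az; apply: acl_gen; left.
rewrite IHs; split.
  case=> nAa [As Ast]; split; first by split.
  by apply: indep_sub Ast => z /adj_consE/acl_gen.
case=> [[nAa As] Ast]; split=> //; split=> //.
by apply: indep_sub Ast => z /adj_consE/acl_gen.
Qed.

(** Indices are selected rather than values, so that the same selection can be evaluated at another
    point. *)
Lemma indep_spanning_subseq (J : eqType) (f : J -> E) A (js : seq J) :
  exists js', [/\ subseq js' js, indep A (map f js')
    & forall j, j \in js -> acl (adj A (map f js')) (f j)].
Proof.
elim: js A => [|j js IHjs] A; first by exists [::].
have [Aj|nAj] := classic (acl A (f j)).
  have [js' [sjs Ajs span]] := IHjs A.
  exists js'; split=> //; first exact: subseq_trans sjs (subseq_cons _ _).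
  move=> i; rewrite inE => /orP[/eqP->|/span//].
  exact: acl_adj_base.
have [js' [sjs Ajs span]] := IHjs (adj1 A (f j)).
exists (j :: js'); split=> //=; first by rewrite eqxx.
move=> i; rewrite inE => /orP[/eqP->|/span].
  by apply: acl_adj_mem; apply: mem_head.
by apply: acl_mono => z /adj_consE.
Qed.

(** An independent spanning subsequence of [s] is as long as [s], hence equal to it. The criterion
    does not see the order of [s]. *)
Lemma indep_of_leq_size A s :
  (forall t, (forall z, z \in s -> acl (adj A t) z) -> (size s <= size t)%N) ->
  indep A s.
Proof.
move=> H; have [s'] := indep_spanning_subseq id A s; rewrite map_id.
case=> sub ind /H sz; suff <- : s' = s by [].
by apply/eqP; rewrite -(size_subseq_leqif sub) eqn_leq sz size_subseq.
Qed.

Lemma indep_perm A s t : perm_eq s t -> indep A s -> indep A t.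
Proof.
move=> pst As; apply: indep_of_leq_size => u tu; rewrite -(perm_size pst).
by apply: indep_leq_size As _ => z; rewrite (perm_mem pst); apply: tu.
Qed.

Lemma indepPn A s : ~ indep A s ->
  exists s1 a s2, s = s1 ++ a :: s2 /\ acl (adj A s1) a.
Proof.
elim: s A => [|a s IHs] A /=; first by case.
have [Aa|nAa] := classic (acl A a).
  by exists [::], a, s; split=> //; apply: acl_adj_base.
move=> nas; have [|s1 [b [s2 [-> Ab]]]] := IHs (adj1 A a).
  by move=> ias; apply: nas.
exists (a :: s1), b, s2; split=> //.
by apply: acl_mono Ab => z /adj_consE.
Qed.

End AlgebraicIndependence.

(** * Algebraic freeness and multivariate polynomials *)

Section MPolyLastVariable.
Variables (R : nzRingType) (n : nat).
Local Notation widen := (widen_ord (leqnSn n)).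

Lemma mmap_mwiden (A : comNzRingType) (f : {rmorphism R -> A})
    (h : 'I_n.+1 -> A) (p : {mpoly R[n]}) :
  mmap f h (mwiden p) = mmap f (h \o widen) p.
Proof.
rewrite {1}/mwiden {2}/mmap raddf_sum /=; apply: eq_bigr => m _.
rewrite rmorphM /= mmapC; congr (_ * _).
rewrite /mmap1 rmorph_prod /=; apply: eq_bigr => i _.
by rewrite rmorphXn /= mmapX mmap1U.
Qed.

Lemma mpolyX_last_var (m : 'X_{1..n.+1}) :
  'X_[m] = mwiden 'X_[[multinom m (widen i) | i < n]] * 'X_ord_max ^+ m ord_max
    :> {mpoly R[n.+1]}.
Proof.
rewrite mwidenX mpolyXn -mpolyXD; congr 'X_[_]; apply/mnmP => i.
rewrite mnmDE mulmnE mnm1E.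
case: (unliftP ord_max i) => [j ->|->]; last first.
  by rewrite mnmwiden_ordmax eqxx mul1n.
rewrite (_ : lift ord_max j = widen j); last first.
  by apply: val_inj; rewrite /= /bump leqNgt ltn_ord.
rewrite mnmwiden_widen mnmE (_ : (ord_max == widen j) = false) ?mul0n ?addn0 //.
by apply/eqP => /(congr1 val) /= jn; have := ltn_ord j; rewrite -{1}jn ltnn.
Qed.
End MPolyLastVariable.

Lemma mpolyOver_mmap (R : comNzRingType) (S : subringClosed R) (n k : nat)
    (h : 'I_n -> {mpoly R[k]}) (p : {mpoly R[n]}) :
  p \is a mpolyOver n S -> (forall i, h i \is a mpolyOver k S) ->
  mmap (@mpolyC k R) h p \is a mpolyOver k S.
Proof.
move=> /mpolyOverP Sp Sh; rewrite /mmap rpred_sum // => m _.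
by rewrite rpredM ?mpolyOverC // rpred_prod // => i _; rewrite rpredX.
Qed.

Lemma mpoly_last_var (R : comNzRingType) (S : subringClosed R) (n : nat)
    (p : {mpoly R[n.+1]}) : p \is a mpolyOver n.+1 S ->
  exists N (Q : nat -> {mpoly R[n]}), (forall j, Q j \is a mpolyOver n S) /\
    p = \sum_(j < N) mwiden (Q j) * 'X_ord_max ^+ j.
Proof.
move=> /mpolyOverP Sp; exists (msize p).
(* The terms of [p] are grouped by their exponent in the last variable, which is below [msize p]. *)
exists (fun j => \sum_(m <- msupp p | m ord_max == j)
  p@_m *: 'X_[[multinom m (widen_ord (leqnSn n) i) | i < n]]); split.
  by move=> j; rewrite rpred_sum // => m _; rewrite mpolyOverZ ?mpolyOverX.
under eq_bigr => j _ do rewrite raddf_sum mulr_suml.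
rewrite (exchange_big_dep xpredT) //= {1}[p]mpolyE; apply: eq_big_seq => m pm.
have lt : (m ord_max < msize p)%N.
  apply: leq_ltn_trans (msize_mdeg_lt pm).
  by rewrite mdegE (bigD1 ord_max) //= leq_addr.
rewrite (big_pred1 (Ordinal lt)) //.
by rewrite mwidenZ -scalerAl -mpolyX_last_var.
Qed.

Section AlgebraicFreeness.
Variables (E : fieldType) (K : E -> Prop).
Hypothesis rK : subring K.

Definition alg_free m (v : 'I_m -> E) : Prop :=
  forall p : {mpoly E[m]}, mpoly_over K p -> p.@[v] = 0 -> p = 0.

(** Induction step linking freeness to [indep]: a polynomial in m+1 variables is one in the last
    variable with coefficients in the others. *)
Lemma alg_free_last m (v : 'I_m.+1 -> E) :
  let w := v \o widen_ord (leqnSn m) in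
  alg_free v <-> alg_free w /\ ~ acl (adj K [seq w i | i <- enum 'I_m]) (v ord_max).
Proof.
move=> w; have [S KS] := subring_pred rK.
have KSm k (p : {mpoly E[k]}) : mpoly_over K p <-> p \is a mpolyOver k S.
  split=> [Kp|/mpolyOverP Sp mo]; last exact/KS.
  by apply/mpolyOverP => mo; apply/KS.
have evw (p : {mpoly E[m]}) : (mwiden p).@[v] = p.@[w] by rewrite /meval mmap_mwiden.
split.
  move=> fv; split.
    move=> p /KSm Sp pw; apply: inj_mwiden; rewrite mwiden0; apply: fv.
      by apply/KSm/mpolyOver_mmap => // i; rewrite mpolyOverX.
    by rewrite evw.
  pose T z := exists2 p : {mpoly E[m]}, p \is a mpolyOver m S & z = p.@[w].
  have rT : subring T.
    split.
    - by exists 1; rewrite ?rpred1 ?meval1.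
    - by move=> _ _ [p Sp ->] [q Sq ->]; exists (p - q); rewrite ?mevalB ?rpredB.
    - by move=> _ _ [p Sp ->] [q Sq ->]; exists (p * q); rewrite ?mevalM ?rpredM.
  move/(acl_alg_over rT); case.
    move=> z [/KS Sz | /mapP[i _ ->]].
      by exists z%:MP; rewrite ?mpolyOverC ?mevalC.
    by exists 'X_i; rewrite ?mpolyOverX ?mevalXU.
  move=> q [q0 Tq qv].
  have /fin_all_exists2[f Sf fE] : forall j : 'I_(size q),
      exists2 p : {mpoly E[m]}, p \is a mpolyOver m S & q`_j = p.@[w].
    by move=> j; apply: Tq.
  pose P := \sum_(j < size q) mwiden (f j) * 'X_ord_max ^+ j.
  have P0 : P = 0.
    apply: fv.
      apply/KSm/rpred_sum => j _; rewrite rpredM ?rpredX ?mpolyOverX //.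
      by apply: mpolyOver_mmap => // i; rewrite mpolyOverX.
    rewrite -(rootP qv) horner_coef raddf_sum /=; apply: eq_bigr => j _.
    by rewrite mevalM evw -fE rmorphXn /= mevalXU.
  (* Substituting ['X] for the last variable and constants for the others turns [P] back into [q],
     so [P = 0] contradicts [q != 0]. *)
  pose h i := if unlift ord_max i is Some j then (w j)%:P else 'X.
  have Ph : mmap (@polyC E) h P = 0 by rewrite P0 raddf0.
  case/eqP: q0; rewrite -Ph raddf_sum /=.
  rewrite -[LHS]coefK poly_def; apply: eq_bigr => j _.
  rewrite rmorphM rmorphXn /= mmapX mmap1U /h unlift_none mmap_mwiden.
  rewrite fE -mul_polyC; congr (_ * _).
  rewrite /meval /mmap rmorph_sum; apply: eq_bigr => mo _.
  rewrite rmorphM /mmap1 rmorph_prod; congr (_ * _); apply: eq_bigr => i _.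
  rewrite rmorphXn /= (_ : widen_ord _ i = lift ord_max i) ?liftK //.
  by apply: val_inj; rewrite /= /bump leqNgt ltn_ord.
case=> fw nv p /KSm Sp pv.
have [N [Q [SQ pE]]] := mpoly_last_var Sp.
pose q := \poly_(j < N) (Q j).@[w].
have qv : root q (v ord_max).
  apply/rootP; rewrite -[RHS]pv pE raddf_sum horner_poly; apply: eq_bigr => j _ /=.
  by rewrite mevalM evw rmorphXn /= mevalXU.
have cA := acl_aclosed (adj K [seq w i | i <- enum 'I_m]).
(* A nonzero [q] would make the last value algebraic over the others; if [q = 0], each [Q j]
   vanishes at [w] and is 0 by freeness. *)
have [q0|qn0] := eqVneq q 0; last first.
  have [rA CA] := cA; have [T AT] := subring_pred rA.
  case: nv; apply: CA; exists q; split=> // j; rewrite coef_poly.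
  case: ltnP => _; last by apply/AT; rewrite rpred0.
  apply/AT; rewrite mevalE rpred_sum // => mo _; apply: rpredM.
    apply/AT; apply: acl_adj_base; apply: acl_gen; apply/KS.
    by move/mpolyOverP: (SQ j).
  apply: rpred_prod => i _; apply: rpredX; apply/AT.
  by apply: acl_adj_mem; apply: map_f; rewrite mem_enum.
rewrite pE big1 // => j _; rewrite (fw (Q j)) ?mwiden0 ?mul0r //.
  exact/KSm.
by have := congr1 (fun r : {poly E} => r`_j) q0; rewrite coef_poly ltn_ord coef0.
Qed.

Lemma indep_alg_free m (v : 'I_m -> E) :
  indep K [seq v i | i <- enum 'I_m] <-> alg_free v.
Proof.
elim: m v => [|m IHm] v.
  rewrite (size0nil (size_enum_ord 0)) /=; split=> // _ p _.
  have -> : p = (p@_0%MM)%:MP.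
    apply/mpolyP => mo; rewrite mcoeffC (_ : mo = 0%MM) ?eqxx ?mulr1 //.
    by apply/mnmP => -[].
  by rewrite mevalC => ->; rewrite mpolyC0.
have cE : [seq v i | i <- enum 'I_m.+1] =
    [seq (v \o widen_ord (leqnSn m)) i | i <- enum 'I_m] ++ [:: v ord_max].
  by rewrite enum_ordSr map_rcons -cats1 -map_comp.
rewrite cE indep_cat IHm alg_free_last /=.
tauto.
Qed.

End AlgebraicFreeness.

(** * Derivations *)

Section Derivation.
Variables (E : fieldType) (D : E -> E).
Hypotheses (dD : derivation D) (char0 : [pchar E] =i pred0).
Implicit Types (A B C : E -> Prop).

Lemma derivation0 : D 0 = 0.
Proof. by have [DD _] := dD; apply: (addIr (D 0)); rewrite -DD !add0r. Qed.

Lemma derivation1 : D 1 = 0.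
Proof.
have [_ /(_ 1 1)] := dD; rewrite !mulr1 mul1r => D11.
by apply: (addIr (D 1)); rewrite add0r -D11.
Qed.

Lemma derivationB a b : D (a - b) = D a - D b.
Proof.
have [DD _] := dD; apply: (addIr (D b)).
by rewrite -DD !subrK.
Qed.

(** The term [c] is the value at [a] of [p] with its coefficients differentiated; only its
    membership in [C] is kept. *)
Lemma derivation_horner C (p : {poly E}) a : subring C -> C a ->
  (forall i, C p`_i /\ C (D p`_i)) ->
  exists2 c, C c & D p.[a] = c + p^`().[a] * D a.
Proof.
move=> /subring_pred[S CS] Ca; have [DD DM] := dD.
elim/poly_ind: p => [|p c IHp] Cp.
  exists 0; first exact/CS/rpred0.
  by rewrite deriv0 !horner0 derivation0 mul0r addr0.
have pE i : p`_i = (p * 'X + c%:P)`_i.+1 by rewrite coefD coefMX coefC addr0.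
have cE : c = (p * 'X + c%:P)`_0 by rewrite coefD coefMX coefC add0r.
have [|e Ce De] := IHp; first by move=> i; rewrite pE.
exists (e * a + D c).
  apply/CS; rewrite rpredD ?rpredM //; do ?exact/CS.
  by rewrite cE; apply/CS; case: (Cp 0).
rewrite derivD derivC addr0 derivM derivX mulr1 !hornerE DD DM De.
by ring.
Qed.

(* Differentiating p(a) = 0 for p of minimal degree gives D a. *)
Lemma aclosed_derivation C : aclosed C -> aclosed (fun z => C z /\ C (D z)).
Proof.
move=> cC; have [rC CA] := cC; have [S CS] := subring_pred rC.
have [DD DM] := dD.
split; first split.
- by rewrite derivation1; split; apply/CS; rewrite ?rpred1 ?rpred0.
- move=> a b [/CS Sa /CS Sda] [/CS Sb /CS Sdb]; rewrite derivationB.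
  by split; apply/CS; rewrite rpredB.
- move=> a b [/CS Sa /CS Sda] [/CS Sb /CS Sdb]; rewrite DM.
  by split; apply/CS; rewrite ?rpredD ?rpredM.
move=> a [p [p0 Cp pa]].
have Ca : C a by apply: CA; exists p; split=> // i; case: (Cp i).
split=> //; have [k] := ubnP (size p); elim: k => // k IHk in p p0 Cp pa *.
rewrite ltnS => szp; have [dpa|dpa] := eqVneq p^`().[a] 0; last first.
  have [c Cc] := derivation_horner rC Ca Cp.
  rewrite (rootP pa) derivation0 => /esym cE.
  have Cdpa : C p^`().[a].
    apply/CS/rpred_horner; last exact/CS.
    by apply/polyOver_deriv/polyOverP => i; apply/CS; case: (Cp i).
  have CNc : C (- c) by apply/CS; rewrite rpredN; apply/CS.
  by apply: (aclosed_linear cC Cdpa CNc dpa); apply/eqP; rewrite -addr_eq0 addrC cE.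
have sz1 : (1 < size p)%N by apply: root_size_gt1 pa.
apply: (IHk p^`()) => //.
- apply/eqP => /(congr1 (fun r : {poly E} => r`_(size p).-2)).
  rewrite coef_deriv coef0 => /eqP; rewrite -mulr_natr mulf_eq0.
  case: (size p) (lead_coefE p) p0 sz1 => [|[|l]] //= lE; rewrite -lead_coef_eq0 lE.
  move=> /negbTE -> _ /=.
  by move/pcharf0P: char0 => ->.
- move=> i; rewrite coef_deriv; have [/CS Sp /CS Sdp] := Cp i.+1.
  have DMn u n : D (u *+ n) = D u *+ n.
    by elim: n => [|n IHn]; rewrite ?mulr0n ?derivation0 // !mulrS DD IHn.
  rewrite DMn.
  by split; apply/CS; rewrite rpredMn.
- exact/rootP.
- exact: leq_trans (lt_size_deriv p0) szp.
Qed.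

Lemma acl_derivation A B a : (forall z, A z -> acl B z /\ acl B (D z)) ->
  acl A a -> acl B (D a).
Proof.
move=> AB /(_ _ (aclosed_derivation (acl_aclosed B))).
by case/(_ AB).
Qed.

(** [G] is a filtration by order of differentiation: each application of [D] climbs one level. *)
Lemma acl_iter_derivation (G : nat -> E -> Prop) l k a :
  (forall l z, G l z -> acl (G l.+1) z /\ acl (G l.+1) (D z)) ->
  acl (G l) a -> acl (G (l + k)%N) (iter k D a).
Proof.
move=> GD Ga; elim: k => [|k IHk]; first by rewrite addn0.
by rewrite addnS iterS; apply: acl_derivation IHk => z; apply: GD.
Qed.

End Derivation.

(** * Derivatives of a point of the variety *)

Lemma map_tnth_seq (J T : Type) (w : J -> T) (js : seq J) :
  map w js = [seq w (tnth (in_tuple js) i) | i <- enum 'I_(size js)].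
Proof. by rewrite [RHS](map_comp w (tnth (in_tuple js))) map_tnth_enum. Qed.

Section DifferentialDimension.
Variables (E : fieldType) (D : E -> E).
Hypotheses (dD : derivation D) (char0 : [pchar E] =i pred0).
Implicit Types (A B C K : E -> Prop).

Lemma alg_indepE K (J : eqType) (w : J -> E) : subring K ->
  alg_indep K w <-> forall js : seq J, uniq js -> indep K (map w js).
Proof.
move=> rK; split=> [iw js ujs | iw m f p finj].
  rewrite map_tnth_seq; apply/(indep_alg_free rK) => p Kp; apply: iw Kp.
  by move=> i1 i2; apply/tuple_uniqP.
have /(indep_alg_free rK) : indep K [seq w (f i) | i <- enum 'I_m].
  by rewrite map_comp; apply: iw; rewrite map_inj_uniq ?enum_uniq.
exact.
Qed.

Lemma not_alg_indep K (J : eqType) (w : J -> E) : subring K -> ~ alg_indep K w ->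
  exists2 js : seq J, uniq js & ~ indep K (map w js).
Proof.
move=> rK niw; apply: NNPP => H; apply: niw; apply/(alg_indepE _ rK) => js ujs.
by apply: NNPP => njs; apply: H; exists js.
Qed.

Variable F : E -> Prop.
Hypothesis dF : diff_subfield D F.

Lemma subring_diff_subfield : subring F.
Proof. by case: dF. Qed.

Section Jets.
Variables (n : nat) (y : 'cV[E]_n).
Implicit Types I : {set 'I_n}.

Definition jet (t : nat * 'I_n) : E := iter t.1 D (y t.2 0).

(** The bound [h] is strict, whereas [djvar k] allows order [k]. *)
Definition jet_idx (I : {set 'I_n}) h : seq (nat * 'I_n) :=
  [seq (l, i) | l <- iota 0 h, i <- enum I].

Lemma mem_jet_idx I h l i : ((l, i) \in jet_idx I h) = (l < h)%N && (i \in I).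
Proof.
apply/allpairsP/andP => [[[l1 i1] /= [l1h i1I [-> ->]]] | [lh iI]].
  by move: l1h i1I; rewrite mem_iota mem_enum.
by exists (l, i); rewrite mem_iota mem_enum.
Qed.

Lemma uniq_jet_idx I h : uniq (jet_idx I h).
Proof.
apply: allpairs_uniq; rewrite ?iota_uniq ?enum_uniq //.
by move=> [? ?] [? ?] _ _ [-> ->].
Qed.

Lemma size_jet_idx I h : size (jet_idx I h) = (h * #|I|)%N.
Proof. by rewrite size_allpairs size_iota -cardE. Qed.

Definition jets I h : seq E := map jet (jet_idx I h).

Lemma mem_jets I h l i : (l < h)%N -> i \in I -> iter l D (y i 0) \in jets I h.
Proof. by move=> lh iI; apply/mapP; exists (l, i); rewrite ?mem_jet_idx ?lh. Qed.

Lemma jetsP I h z : z \in jets I h ->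
  exists l i, [/\ (l < h)%N, i \in I & z = iter l D (y i 0)].
Proof.
by case/mapP=> -[l i]; rewrite mem_jet_idx => /andP[lh iI] ->; exists l, i.
Qed.

Lemma jets_sub I I' h h' z : I \subset I' -> (h <= h')%N ->
  z \in jets I h -> z \in jets I' h'.
Proof.
move=> /subsetP II' hh' /jetsP[l [i [lh /II' iI ->]]].
by apply: mem_jets; first exact: leq_trans hh'.
Qed.

Lemma diff_indep_jets (I : {set 'I_n}) (js : seq (nat * 'I_n)) :
  diff_indep D F (fun i : {i | i \in I} => y (val i) 0) ->
  uniq js -> (forall t, t \in js -> t.2 \in I) -> indep F (map jet js).
Proof.
move=> /(alg_indepE _ subring_diff_subfield) iI ujs jsI.
(* Indices are lifted to the subtype of [I]; [pmap] drops none, since all of them lie in [I]. *)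
pose lift_idx (t : nat * 'I_n) : option (nat * {i | i \in I}) :=
  omap (pair t.1) (insub t.2).
have liftE : map (fun t => (t.1, val t.2)) (pmap lift_idx js) = js.
  elim: js jsI {ujs} => //= -[l i] js IHjs jsI.
  rewrite /lift_idx /= insubT /=; first exact: jsI (l, i) (mem_head _ _).
  by move=> iI'; rewrite IHjs // => t tjs; apply: jsI; rewrite inE tjs orbT.
rewrite -liftE -map_comp; apply: iI.
by rewrite -liftE in ujs; apply: map_uniq ujs.
Qed.

(** A dependent finite family has bounded order, and independence of all jets up to that order would
    pass to it after permuting it to the front. *)
Lemma diff_dependent_jets (I : {set 'I_n}) :
  ~ diff_indep D F (fun i : {i | i \in I} => y (val i) 0) ->
  exists h, ~ indep F (jets I h).
Proof.
case/(not_alg_indep subring_diff_subfield) => js ujs njs.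
pose js0 := [seq (t.1, val t.2) | t <- js].
exists (\max_(t <- js0) t.1).+1 => iI.
have ujs0 : uniq js0.
  by rewrite map_inj_uniq // => -[l i] [l' i'] [-> /val_inj ->].
set h := (\max_(t <- js0) t.1).+1 in iI.
have sub : {subset js0 <= jet_idx I h}.
  move=> t tjs; rewrite [t]surjective_pairing mem_jet_idx ltnS; apply/andP; split.
    by apply: (leq_bigmax_seq (F := fun t : nat * 'I_n => t.1)).
  by case/mapP: tjs => u _ ->; apply: (valP u.2).
pose rest := [seq t <- jet_idx I h | t \notin js0].
have : perm_eq (map jet (jet_idx I h)) (map jet (js0 ++ rest)).
  apply: perm_map; apply: uniq_perm; first exact: uniq_jet_idx.
    rewrite cat_uniq ujs0 filter_uniq ?uniq_jet_idx // andbT.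
    by apply/hasPn => t; rewrite mem_filter => /andP[].
  move=> t; rewrite [RHS]mem_cat mem_filter.
  by case: (boolP (t \in js0)) => //= /sub ->.
move/indep_perm/(_ iI); rewrite map_cat => /indep_cat[].
by rewrite -map_comp.
Qed.

End Jets.

(** * Growth of the jets of a generic point *)

Section Generic.
Variables (n d : nat) (eta : 'cV[E]_n).

(* The first dependent derivative of [eta i] is algebraic over the jets of the
   basis [I] and the lower derivatives of [eta i]; differentiating this relation
   [m] times raises the order in [I] by [m] but not the order in [eta i]. *)
Lemma jets_over_basis (I : {set 'I_n}) (i : 'I_n) :
  diff_indep D F (fun i : {i | i \in I} => eta (val i) 0) ->
  (i \notin I ->
     ~ diff_indep D F (fun j : {j | j \in i |: I} => eta (val j) 0)) ->
  exists e, forall j,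
    acl (adj (adj F (jets eta I (e + j).+1)) (jets eta [set i] e))
        (iter j D (eta i 0)).
Proof.
move=> iI dep; have [iIn|niI] := boolP (i \in I).
  by exists 0%N => j; apply: acl_adj_base; apply: acl_adj_mem; apply: mem_jets.
have [h nih] := diff_dependent_jets (dep niI).
pose low := [seq (l, i) | l <- iota 0 h].
(* With the jets of [I] first, which are independent, the dependence must occur among the
   derivatives of [eta i]. *)
have perm : perm_eq (map (jet eta) (jet_idx I h ++ low)) (jets eta (i |: I) h).
  apply: perm_map; apply: uniq_perm; last 1 first.
  - move=> [l j]; rewrite mem_cat !mem_jet_idx in_setU1.
    have -> : ((l, j) \in low) = (l < h)%N && (j == i).
      apply/mapP/andP => [[l' l'h [-> ->]]|[lh /eqP->]].
        by move: l'h; rewrite mem_iota eqxx.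
      by exists l; rewrite ?mem_iota.
    by rewrite -andb_orr orbC.
  - rewrite cat_uniq uniq_jet_idx map_inj_uniq ?iota_uniq ?andbT; last first.
      by move=> ? ? [].
    apply/hasPn => _ /mapP[l _ ->]; rewrite mem_jet_idx (negPf niI).
    by rewrite andbF.
  - exact: uniq_jet_idx.
have iIh : indep F (jets eta I h).
  apply: diff_indep_jets iI _ _; first exact: uniq_jet_idx.
  by case=> l j; rewrite mem_jet_idx => /andP[].
have : ~ indep (adj F (jets eta I h)) (map (jet eta) low).
  move=> il; apply: nih; apply: indep_perm perm _; rewrite map_cat.
  by apply/indep_cat.
case/indepPn => s1 [a [s2 [lowE s1a]]].
set e := size s1 in lowE s1a.
have s1E l : (l < e)%N -> iter l D (eta i 0) \in jets eta [set i] e.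
  by move=> le; apply: mem_jets; rewrite ?inE.
have sz : (e < h)%N.
  have := congr1 size lowE; rewrite !size_map size_iota size_cat /= => ->.
  by rewrite addnS ltnS leq_addr.
have nthE l : (l < h)%N -> nth 0 (map (jet eta) low) l = iter l D (eta i 0).
  move=> lh; rewrite (nth_map (0%N, i)) ?size_map ?size_iota //.
  by rewrite (nth_map 0%N) ?size_iota // nth_iota.
have aE : a = iter e D (eta i 0).
  by rewrite -nthE // lowE nth_cat ltnn subnn.
pose G l := adj (adj F (jets eta I (h + l))) (jets eta [set i] e).
have G0 : acl (G 0%N) (iter e D (eta i 0)).
  rewrite -aE; apply: acl_mono s1a => z; rewrite /G addn0 => -[|zs1].
    by left.
  right; have lt : (index z s1 < e)%N by rewrite index_mem.
  have -> : z = nth 0 (map (jet eta) low) (index z s1).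
    by rewrite lowE nth_cat lt nth_index.
  by rewrite nthE ?s1E // (ltn_trans lt).
have Gmono l z : G 0%N z -> G l z.
  case=> [[Fz|zI]|zi]; [by left; left | | by right].
  by left; right; apply: jets_sub zI; rewrite // addn0 leq_addr.
have GD l z : G l z -> acl (G l.+1) z /\ acl (G l.+1) (D z).
  case=> [[Fz|/jetsP[m [j [mh jI ->]]]]|/jetsP[m [j [me /set1P-> ->]]]].
  - have [_ _ _ _ FD] := dF; have [_ FDz] := FD _ Fz.
    by split; apply: acl_gen; left; left.
  - split; apply: acl_adj_base; apply: acl_adj_mem; last rewrite -iterS.
      by apply: mem_jets; rewrite // addnS ltnS ltnW.
    by apply: mem_jets; rewrite // addnS ltnS.
  - split; first by apply: acl_adj_mem; apply: s1E.
    rewrite -iterS; have [lt|ge] := ltnP m.+1 e.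
      by apply: acl_adj_mem; apply: s1E.
    (* Differentiation leaves the list of lower derivatives only at order [e], where [G0]
       applies. *)
    have -> : m.+1 = e by apply/eqP; rewrite eqn_leq me ge.
    by apply: acl_mono G0 => z0; apply: Gmono.
exists (h + e)%N => j; have [je|ej] := ltnP j e.
  by apply: acl_adj_mem; apply: mem_jets; rewrite ?inE // ltn_addl.
have -> : iter j D (eta i 0) = iter (j - e)%N D (iter e D (eta i 0)).
  by rewrite -iterD subnK.
have := acl_iter_derivation (k := (j - e)%N) dD char0 GD G0; rewrite add0n.
apply: acl_mono => z [[Fz|zI]|zi]; [by left; left | left; right | right].
  by apply: jets_sub zI; rewrite // -addnA -addnS leq_add2l leqW //; lia.
by apply: jets_sub zi; rewrite // leq_addl.
Qed.

Lemma generic_jets_bound : diff_trdeg D F eta d ->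
  exists c, forall k, exists2 t, (size t <= d * k + c)%N &
    forall j i, (j <= k)%N -> acl (adj F t) (iter j D (eta i 0)).
Proof.
case=> -[I [cI iI]] maxI.
have /fin_all_exists[e He] : forall i : 'I_n, exists e, forall j,
    acl (adj (adj F (jets eta I (e + j).+1)) (jets eta [set i] e))
        (iter j D (eta i 0)).
  move=> i; apply: jets_over_basis => // niI /maxI.
  by rewrite cardsU1 niI cI ltnn.
pose M := (\max_i e i)%N.
(* The jets of [I] of order at most [M + k] number (M+k+1)d, and those of all coordinates of order
   below [M] number Mn. *)
exists (M.+1 * d + M * n)%N => k.
exists (jets eta I (M + k).+1 ++ jets eta setT M).
  rewrite size_cat !size_map !size_jet_idx cI cardsT card_ord addnA leq_add2r.
  by rewrite -addSn mulnDl addnC [(k * d)%N]mulnC.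
move=> j i jk; apply: acl_mono (He i j) => z.
have eM : (e i <= M)%N by apply: leq_bigmax.
case=> [[Fz|zI]|zi]; [by left | right | right]; rewrite mem_cat; apply/orP.
  by left; apply: jets_sub zI; rewrite // ltnS leq_add.
by right; apply: jets_sub zi; rewrite ?subsetT.
Qed.

End Generic.

Lemma mpoly_over_comp (k m : nat) (q : m.-tuple {mpoly E[k]}) (p : {mpoly E[m]}) :
  mpoly_over F p -> (forall i, mpoly_over F (tnth q i)) -> mpoly_over F (p \mPo q).
Proof.
have [S FS] := subring_pred subring_diff_subfield.
have FSm l (r : {mpoly E[l]}) : mpoly_over F r <-> r \is a mpolyOver l S.
  split=> [Kp|/mpolyOverP Sp mo]; last exact/FS.
  by apply/mpolyOverP => mo; apply/FS.
move=> /FSm Sp Sq; apply/FSm/mpolyOver_mmap => // i; exact/FSm.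
Qed.

Lemma mpoly_over_X (k : nat) i : mpoly_over F ('X_i : {mpoly E[k]}).
Proof.
have [F0 F1 _ _ _] := dF => mo; rewrite mcoeffX.
by case: (_ == _).
Qed.

Lemma djet_rank n k (y : 'cV[E]_n) (t : djvar k n) :
  djet D y (enum_rank t) = iter t.1 D (y t.2 0).
Proof. by rewrite /djet enum_rankK; case: t. Qed.

(** * Specialization from the generic point to points of the variety *)

Section Specialization.
Variables (n d : nat) (V : 'cV[E]_n -> Prop) (eta : 'cV[E]_n).
Hypothesis gen : generic_point D F V eta.

(** A relation over [F] among derivatives of [eta] is a differential polynomial vanishing at [eta],
    hence at [y]. *)
Lemma indep_jets_generic k (js : seq (djvar k n)) y : V y ->
  indep F [seq iter (val t.1) D (y t.2 0) | t <- js] ->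
  indep F [seq iter (val t.1) D (eta t.2 0) | t <- js].
Proof.
move=> Vy; have rF := subring_diff_subfield.
have mapE (u : 'cV[E]_n) : [seq iter (val t.1) D (u t.2 0) | t <- js] =
    [seq iter (val (tnth (in_tuple js) i).1) D (u (tnth (in_tuple js) i).2 0)
       | i <- enum 'I_(size js)].
  exact: map_tnth_seq.
rewrite !mapE => /(indep_alg_free rF) fy; apply/(indep_alg_free rF) => p Fp peta.
apply: fy => //.
(* Renaming the variables of [p] to jet variables makes it a differential polynomial. *)
pose q : (size js).-tuple {mpoly E[#|{: djvar k n}|]} :=
  [tuple 'X_(enum_rank (tnth (in_tuple js) i)) | i < size js].
have evE u : deval D (DPoly (p \mPo q)) u =
    p.@[fun i => iter (val (tnth (in_tuple js) i).1) D
                   (u (tnth (in_tuple js) i).2 0)].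
  rewrite /deval /= comp_mpoly_meval; apply: meval_eq => i.
  by rewrite tnth_mktuple mevalXU djet_rank.
rewrite -evE; case: gen => _; apply=> //; last by rewrite evE.
apply: mpoly_over_comp => // i; rewrite tnth_mktuple; exact: mpoly_over_X.
Qed.

(** A transcendence basis of the jets of [y] stays independent at [eta], where the bound for the
    generic point limits its size. *)
Lemma variety_jets_bound : diff_trdeg D F eta d ->
  exists c, forall k y, V y -> exists2 s, (size s <= d * k + c)%N &
    forall j i, (j <= k)%N -> acl (adj F s) (iter j D (y i 0)).
Proof.
case/generic_jets_bound=> c Hc; exists c => k y Vy.
have [t szt span_eta] := Hc k.
have [js [_ ijs span]] := indep_spanning_subseq
  (fun t : djvar k n => iter (val t.1) D (y t.2 0)) F (enum {: djvar k n}).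
exists [seq iter (val t.1) D (y t.2 0) | t <- js].
  apply: leq_trans szt; rewrite size_map.
  rewrite -(size_map (fun t : djvar k n => iter (val t.1) D (eta t.2 0))).
  apply: indep_leq_size (indep_jets_generic Vy ijs) _.
  by move=> _ /mapP[u _ ->]; apply: span_eta; rewrite -ltnS ltn_ord.
move=> j i jk; rewrite -ltnS in jk.
by have := span (Ordinal jk, i); apply; rewrite mem_enum.
Qed.

End Specialization.

End DifferentialDimension.

(** * Hyperplanes through a point *)

Section HyperplaneCoefficient.
Variables (E : fieldType) (n : nat).
Hypothesis char0 : [pchar E] =i pred0.

Lemma natr2_neq0 : (2%:R : E) != 0.
Proof. by move/pcharf0P: char0 => ->. Qed.

(* [Defs.skew] is qualified because MathComp's sesquilinear notation [skew]
   shadows it. *)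
Lemma skew_entry (m : nat) (S : 'M[E]_m) (a b : 'I_m) :
  Defs.skew S -> S b a = - S a b.
Proof. by move=> /matrixP/(_ a b); rewrite !mxE. Qed.

Lemma skew_diag (m : nat) (S : 'M[E]_m) (a : 'I_m) : Defs.skew S -> S a a = 0.
Proof.
move=> /(skew_entry a a)/eqP; rewrite -addr_eq0 -mulr2n -mulr_natr mulf_eq0.
by rewrite (negPf natr2_neq0) orbF => /eqP.
Qed.

Lemma on_hyperplaneE (S : 'M[E]_(1 + n)) (x y : 'cV[E]_n) :
  on_hyperplane S x y <->
  \sum_(p : 'I_(1 + n) * 'I_(1 + n)) hvec y p.1 0 * (S p.1 p.2 * hvec x p.2 0) = 0.
Proof.
rewrite -(pair_bigA _ (fun a b => hvec y a 0 * (S a b * hvec x b 0))) /=.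
have -> : \sum_a \sum_b hvec y a 0 * (S a b * hvec x b 0) =
    ((hvec y)^T *m (S *m hvec x)) 0 0.
  by rewrite mxE; apply: eq_bigr => a _; rewrite -mulr_sumr !mxE.
split=> [->|H]; first by rewrite mxE.
by apply/matrixP => i j; rewrite !ord1 H mxE.
Qed.

(** Swapping the two indices shows that the quadratic form equals its own negative. *)
Lemma on_hyperplane_refl (S : 'M[E]_(1 + n)) (x : 'cV[E]_n) :
  Defs.skew S -> on_hyperplane S x x.
Proof.
move=> skS; apply/on_hyperplaneE; set s := \sum_p _.
have swap_inj : injective (fun p : 'I_(1 + n) * 'I_(1 + n) => (p.2, p.1)).
  by move=> [? ?] [? ?] [-> ->].
have /eqP : s = - s.
  rewrite {1}/s (reindex_inj swap_inj) /= -sumrN.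
  apply: eq_bigr => -[a b] _ /=; rewrite (skew_entry a b skS).
  by ring.
rewrite -addr_eq0 -mulr2n -mulr_natr mulf_eq0 (negPf natr2_neq0) orbF.
by move/eqP.
Qed.

(* The coefficient of [S 0 j] in the equation of the hyperplane at [y] is
   [x j - y j], so this entry is rational in the others, [x] and [y]. *)
Lemma aclosed_hyperplane_entry (C : E -> Prop) (S : 'M[E]_(1 + n))
    (x y : 'cV[E]_n) (j : 'I_n) :
  aclosed C -> Defs.skew S -> on_hyperplane S x y -> y j 0 != x j 0 ->
  (forall i, C (x i 0)) -> (forall i, C (y i 0)) ->
  (forall a b : 'I_(1 + n), (a < b)%N -> (a, b) != (lshift n 0, rshift 1 j) ->
     C (S a b)) ->
  C (S (lshift n 0) (rshift 1 j)).
Proof.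
move=> cC skS /on_hyperplaneE hS yxj Cx Cy CS.
have [T CT] := subring_pred (proj1 cC).
have hC (u : 'cV[E]_n) : (forall i, C (u i 0)) -> forall a, hvec u a 0 \in T.
  move=> Cu a; rewrite mxE; case: splitP => [k _|k _]; last exact/CT.
  by rewrite mxE ord1 eqxx rpred1.
set a0 := lshift n 0; set b0 := rshift 1 j.
have h0 u : hvec u a0 0 = 1 :> E by rewrite col_mxEu mxE eqxx.
have hj u : hvec u b0 0 = u j 0 :> E by rewrite col_mxEd.
move: hS; rewrite (bigD1 (a0, b0)) // (bigD1 (b0, a0)) //=.
set r := \sum_(p | _) _; rewrite !h0 !hj (skew_entry a0 b0 skS) => hS.
have Cr : r \in T.
  apply: rpred_sum => -[a b]; rewrite !xpair_eqE /= => /andP[n1 n2].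
  apply: rpredM; first exact: hC.
  apply: rpredM; last exact: hC.
  case: (ltngtP a b) => [ab|ba|/val_inj ->].
  - by apply/CT/CS.
  - rewrite (skew_entry b a skS) rpredN; apply/CT/CS => //.
    by rewrite xpair_eqE andbC.
  - by rewrite skew_diag // rpred0.
apply: (aclosed_linear (u := x j 0 - y j 0) (v := - r) cC).
- by apply/CT; rewrite rpredB //; apply/CT.
- by apply/CT; rewrite rpredN.
- by rewrite subr_eq0 eq_sym.
- apply/eqP; rewrite -addr_eq0; apply/eqP; rewrite -[RHS]hS; ring.
Qed.

End HyperplaneCoefficient.

(** * Counting derivatives of the hyperplane entries *)

Section HyperplanesThroughPoint.
Variables (E : fieldType) (D : E -> E) (F : E -> Prop) (n c : nat).
Hypotheses (dD : derivation D) (char0 : [pchar E] =i pred0).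
Hypothesis dF : diff_subfield D F.
Variables (x : 'cV[E]_n) (S : 'I_c -> 'M[E]_(1 + n)).
Hypothesis indS : indep_generic_hyperplanes D F x S.

Let T : eqType := upper_idx c (1 + n).
Let entry (t : nat * T) : E :=
  iter t.1 D (S (val t.2).1.1 (val t.2).1.2 (val t.2).2).

(* The polynomials over [F] in the derivatives of [x] of order at most [k] form a
   subring of F<x>; bounding the order avoids comparing polynomials of
   different orders. *)
Definition jet_ring k (z : E) : Prop :=
  exists2 p : {mpoly E[#|{: djvar k n}|]}, mpoly_over F p & z = p.@[djet D x].

Lemma subring_jet_ring k : subring (jet_ring k).
Proof.
have [R FR] := subring_pred (subring_diff_subfield dF).
have FRm (p : {mpoly E[#|{: djvar k n}|]}) :
    mpoly_over F p <-> p \is a mpolyOver #|{: djvar k n}| R.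
  split=> [Kp|/mpolyOverP Sp mo]; last exact/FR.
  by apply/mpolyOverP => mo; apply/FR.
split.
- by exists 1; rewrite ?meval1 //; apply/FRm/rpred1.
- move=> _ _ [p /FRm Rp ->] [q /FRm Rq ->].
  by exists (p - q); rewrite ?mevalB //; apply/FRm/rpredB.
- move=> _ _ [p /FRm Rp ->] [q /FRm Rq ->].
  by exists (p * q); rewrite ?mevalM //; apply/FRm/rpredM.
Qed.

Lemma jet_ring_base k z : F z -> jet_ring k z.
Proof.
move=> Fz; exists z%:MP; rewrite ?mevalC // => mo; rewrite mcoeffC.
case: (_ == _); rewrite ?mulr1 ?mulr0 //; by case: dF.
Qed.

Lemma jet_ring_jet k l i : (l <= k)%N -> jet_ring k (iter l D (x i 0)).
Proof.
rewrite -ltnS => lk; exists 'X_(enum_rank (Ordinal lk, i)).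
  exact: (mpoly_over_X dF).
by rewrite mevalXU djet_rank.
Qed.

Lemma jet_ring_dgen k z : jet_ring k z -> dgen D F x z.
Proof.
case=> p Fp ->; have [F0 F1 _ _ _] := dF.
exists (DPoly p), (@DPoly E n 0 1); split=> //.
- by move=> mo; rewrite mcoeff1; case: (_ == _).
- by rewrite /deval meval1 oner_neq0.
- by rewrite /deval meval1 divr1.
Qed.

Lemma entries_indep k (js : seq (nat * T)) :
  uniq js -> indep (jet_ring k) (map entry js).
Proof.
have : alg_indep (jet_ring k) entry.
  move=> m f p finj Kp; case: indS => _; apply=> // mo.
  exact/jet_ring_dgen/Kp.
by move/(alg_indepE entry (subring_jet_ring k)); apply.
Qed.

Lemma lshift_lt_rshift (i : 'I_1) (j : 'I_n) : (lshift n i < rshift 1 j)%N.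
Proof. by rewrite ord1. Qed.

Definition first_entry_idx (j : 'I_n) (q : 'I_c) : T :=
  exist _ (q, lshift n 0, rshift 1 j) (lshift_lt_rshift 0 j).

(** The (k+1)c derivatives of the entries solved for are independent over the jets of [x] and of the
    other entries, yet algebraic over these together with [s]. *)
Lemma hyperplanes_meet_bound (y : 'cV[E]_n) k s :
  y <> x -> (forall q, on_hyperplane (S q) x y) ->
  (forall j i, (j <= k)%N -> acl (adj F s) (iter j D (y i 0))) ->
  (k.+1 * c <= size s)%N.
Proof.
move=> yx hy ys.
have [j yxj] : exists j, y j 0 != x j 0.
  apply: NNPP => H; apply: yx; apply/matrixP => i i'; rewrite ord1.
  by apply/eqP/negPn/negP => yxi; apply: H; exists i.
pose u := first_entry_idx j.
pose js := [seq (l, u q) | l <- iota 0 k.+1, q <- enum 'I_c].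
have ujs : uniq js.
  apply: allpairs_uniq; rewrite ?iota_uniq ?enum_uniq //.
  by move=> [l q] [l' q'] _ _ [-> ->].
pose all_idx := [seq (l, t) | l <- iota 0 k.+1, t <- enum {: upper_idx c (1 + n)}].
(* Listing the other entries first makes [js] independent over a base that contains them. *)
pose others := [seq t : nat * T <- all_idx | t \notin js].
have uall : uniq (others ++ js).
  rewrite cat_uniq ujs filter_uniq ?andbT; last first.
    apply: allpairs_uniq; rewrite ?iota_uniq ?enum_uniq //.
    by move=> [? ?] [? ?] _ _ [-> ->].
  by apply/hasPn => t tjs; rewrite mem_filter negb_and negbK tjs.
have := entries_indep k uall; rewrite map_cat => /indep_cat[_ ind].
have -> : (k.+1 * c)%N = size (map entry js).
  by rewrite size_map size_allpairs size_iota size_enum_ord.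
apply: indep_leq_size ind _ => _ /mapP[_ /allpairsP[[l q] [lk _ ->]] ->].
rewrite mem_iota add0n ltnS /= in lk.
(* Level [m] holds the derivatives of order at most [m] of [x], [y] and the entries not solved for;
   the equations put the solved entries in the closure of level 0. *)
pose G m z := [\/ F z,
  exists l i, (l <= m)%N /\ (z = iter l D (x i 0) \/ z = iter l D (y i 0))
  | exists l (t : T), [/\ (l <= m)%N, forall q, t <> u q & z = entry (l, t)]].
have GD m z : G m z -> acl (G m.+1) z /\ acl (G m.+1) (D z).
  case=> [Fz | [l' [i [lm zE]]] | [l' [t [lm tu ->]]]].
  - have [_ _ _ _ FD] := dF; have [_ FDz] := FD _ Fz.
    by split; apply: acl_gen; constructor 1.
  - split; apply: acl_gen; constructor 2; first by exists l', i; rewrite leqW.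
    by exists l'.+1, i; split=> //; case: zE => ->; [left|right].
  - split; apply: acl_gen; constructor 3; first by exists l', t; rewrite leqW.
    by exists l'.+1, t.
have Gu : acl (G 0%N) (S q (lshift n 0) (rshift 1 j)).
  apply: (aclosed_hyperplane_entry char0 (acl_aclosed _) _ (hy q) yxj).
  - by case: indS.
  - by move=> i; apply: acl_gen; constructor 2; exists 0%N, i; split=> //; left.
  - by move=> i; apply: acl_gen; constructor 2; exists 0%N, i; split=> //; right.
  - move=> a b ab abn; apply: acl_gen; constructor 3.
    exists 0%N, (exist _ (q, a, b) ab); split=> // q' /(congr1 val) /= [_ aE bE].
    by move: abn; rewrite aE bE eqxx.
have := acl_iter_derivation (k := l) dD char0 GD Gu; rewrite add0n.
apply: acl_sub => z [Fz | [l' [i [ll [->|->]]]] | [l' [t [ll tu ->]]]].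
- by apply: acl_adj_base; apply: acl_adj_base; apply: acl_gen; apply: jet_ring_base.
- apply: acl_adj_base; apply: acl_adj_base; apply: acl_gen; apply: jet_ring_jet.
  exact: leq_trans lk.
- apply: acl_mono (ys l' i (leq_trans ll lk)) => w [Fw|]; last by right.
  by left; left; apply: jet_ring_base.
- apply: acl_adj_base; apply: acl_adj_mem; apply: map_f.
  rewrite mem_filter; apply/andP; split.
    by apply/negP => /allpairsP[[l0 q0] /= [_ _ [_ /tu]]].
  apply/allpairsP; exists (l', t); split; rewrite ?mem_enum //.
  by rewrite mem_iota add0n ltnS (leq_trans ll).
Qed.

End HyperplanesThroughPoint.

Theorem theorem4p42 (E : fieldType) (D : E -> E) (F : E -> Prop)
  (n : nat) (V : 'cV[E]_n -> Prop) (d : nat) (x : 'cV[E]_n)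
  (S : 'I_d.+1 -> 'M[E]_(1 + n)) :
  diff_setting D F ->
  irreducible_diff_variety D F V ->
  diff_dim D F V d ->
  indep_generic_hyperplanes D F x S ->
  (V x <-> exists y, V y /\ forall k : 'I_d.+1, on_hyperplane (S k) x y).
Proof.
move=> [dD char0 dF _] _ [eta [gen trd]] indS; split=> [Vx | [y [Vy hy]]].
  exists x; split=> // q; apply: on_hyperplane_refl => //.
  by case: indS.
have [<-//|yx] := classic (y = x).
have [c Hc] := variety_jets_bound dD char0 dF gen trd.
(* Order k = c suffices: (c+1)(d+1) <= dc + c = c(d+1) is false. *)
have [s szs ys] := Hc c y Vy.
have := leq_trans (hyperplanes_meet_bound dD char0 dF indS yx hy ys) szs.
by nia.
Qed.
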